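(* Let $\mathfrak D$ be a unique factorization domain of characteristic zero satisfying $\mathfrak D\cap\mathbb Q=\mathbb Z$ inside the field of fractions $Q(\mathfrak D)$. Let $b,e\in\mathbb N$ be such that $b$ (that is, $b\cdot 1_{\mathfrak D}$) is a prime element of $\mathfrak D$, and let $d=b^e$. Let $p\in\mathfrak D[x]$ be a nice polynomial of degree $d$ having $0$ as a root. Then: (a) all of the roots of $p$ are multiples of $b$ in $\mathfrak D$; (b) at most $e$ of the $d-1$ critical points of $p$ (counted with multiplicity) are not multiples of $b$ in $\mathfrak D$; (c) if moreover $0$ is a root of $p$ of multiplicity one and $b$ divides $e$ in $\mathfrak D$, then additionally: (c1) at least one nonzero root of $p$ is a multiple of $b^2$ in $\mathfrak D$; (c2) at most $e-1$ of the critical points of $p$ (counted with multiplicity) are not multiples of $b$ in $\mathfrak D$.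
   Context: For an integral domain $\mathfrak D$ of characteristic zero, $\mathbb Z$ is identified with the subring $\mathbb Z\cdot 1_{\mathfrak D}$ and $\mathbb Q$ with the subfield $\mathbb Q\cdot 1_{\mathfrak D}$ of $Q(\mathfrak D)$. The derivative $p'$ is the formal derivative. A polynomial of positive degree $n$ splits over $\mathfrak D$ if it equals $c\prod_{i=1}^n(x-x_i)$ with $c,x_1,\dots,x_n\in\mathfrak D$, $c\neq0$. A polynomial $p\in\mathfrak D[x]$ of degree $d\ge2$ is called nice if both $p$ and $p'$ split over $\mathfrak D$; its roots are the $d$ roots of $p$ and its critical points are the $d-1$ roots of $p'$, each repeated according to multiplicity. $\mathbb N$ denotes the positive integers. *)

(* Defs.v *)
From mathcomp Require Import all_boot all_order all_algebra.
From mathcomp Require Import boolp.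

Set Implicit Arguments.
Unset Strict Implicit.
Unset Printing Implicit Defensive.

Import GRing.Theory.
Local Open Scope ring_scope.

Section Divisibility.
Variable D : idomainType.

Definition divides (a x : D) : Prop := exists c : D, x = c * a.

Definition prime_elt (a : D) : Prop :=
  [/\ a != 0, a \isn't a GRing.unit
    & forall x y : D, divides a (x * y) -> divides a x \/ divides a y].

Definition irreducible_elt (a : D) : Prop :=
  [/\ a != 0, a \isn't a GRing.unit
    & forall x y : D,
        a = x * y -> x \is a GRing.unit \/ y \is a GRing.unit].

Definition associates (x y : D) : Prop :=
  exists2 u : D, u \is a GRing.unit & y = u * x.

End Divisibility.

Definition factorial_domain (D : idomainType) : Prop :=
  (forall x : D, x != 0 -> x \isn't a GRing.unit ->
     exists2 s : seq D, (forall a, a \in s -> irreducible_elt a)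
                      & x = \prod_(a <- s) a)
  /\
  (forall s t : seq D,
     (forall a, a \in s -> irreducible_elt a) ->
     (forall a, a \in t -> irreducible_elt a) ->
     \prod_(a <- s) a = \prod_(a <- t) a ->
     exists t' : seq D,
       [/\ perm_eq t t', size s = size t'
         & forall i, (i < size s)%N -> associates s`_i t'`_i]).

Definition char_zero (D : idomainType) : Prop := [pchar D] =i pred0.

(* The intersection is taken in {fraction D}.  When D has characteristic zero,
   ratr is the embedding of rat into that field. *)
Definition rational_elts_are_integers (D : idomainType) : Prop :=
  forall x : D,
    (exists q : rat, FracField.tofrac x = ratr q) <->
    (exists z : int, x = z%:~R).

Section Nice.
Variable D : idomainType.

Definition root_list (p : {poly D}) (s : seq D) : Prop :=
  size s = (size p).-1 /\
  exists2 c : D, c != 0 & p = c *: \prod_(x <- s) ('X - x%:P).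

Definition splits (p : {poly D}) : Prop :=
  (1 < size p)%N /\ exists s : seq D, root_list p s.

Definition nice (p : {poly D}) : Prop :=
  [/\ (2 <= (size p).-1)%N, splits p & splits p^`()].

(* Divisibility is not decidable in D, hence the classical boolean. *)
Definition nb_non_multiples (a : D) (s : seq D) : nat :=
  count (fun x => ~~ `[< divides a x >]) s.

End Nice.

(* Main.v *)
Require Import Defs.
From mathcomp Require Import all_boot all_order all_algebra.
From mathcomp Require Import boolp.
From mathcomp Require Import zify ring.

(** Write p = c q with q monic, and q' = d f with f = \prod (X - y_j).  Then
    b^e f_k = (k+1) q_{k+1}, so every q_k with k < d is divisible by b: modulo
    the prime b, q is X^d, whence all roots are multiples of b.  Then q_k is
    even divisible by b^(d-k), so b divides f_k for k < d-1-e (for k < d-e if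
    b divides e): modulo b, f is a multiple of that power of X, which bounds the
    number of y_j that b does not divide.  If 0 is a simple root, the product of
    the d-1 nonzero roots is, up to sign, b^e \prod y_j, and at least d-e of the
    y_j are multiples of b; so b^d divides this product and b^2 divides one of
    its factors. *)

Set Implicit Arguments.
Unset Strict Implicit.
Unset Printing Implicit Defensive.

Import GRing.Theory Num.Theory.
Local Open Scope ring_scope.

(** * Powers of a prime element dividing products *)

Section Divisibility.
Variable D : idomainType.
Implicit Types a c x y z : D.

Lemma divides0 a : divides a 0.
Proof. by exists 0; rewrite mul0r. Qed.

Lemma dividesMl a x y : divides a y -> divides a (x * y).
Proof. by case=> z ->; exists (x * z); rewrite mulrA. Qed.

Lemma dividesMr a x y : divides a x -> divides a (x * y).
Proof. by rewrite mulrC; apply: dividesMl. Qed.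

Lemma dividesD a x y : divides a x -> divides a y -> divides a (x + y).
Proof. by move=> [u ->] [v ->]; exists (u + v); rewrite mulrDl. Qed.

Lemma dividesN a x : divides a x -> divides a (- x).
Proof. by move=> [u ->]; exists (- u); rewrite mulNr. Qed.

Lemma divides_mul a c x y :
  divides a x -> divides c y -> divides (a * c) (x * y).
Proof. by move=> [u ->] [v ->]; exists (u * v); rewrite mulrACA. Qed.

Lemma divides_trans a c x : divides a c -> divides c x -> divides a x.
Proof. by move=> a_c [u ->]; apply: dividesMl. Qed.

Lemma divides_expr_le a m n : (m <= n)%N -> divides (a ^+ m) (a ^+ n).
Proof. by move=> le_mn; exists (a ^+ (n - m)); rewrite -exprD subnK. Qed.

Lemma divides_cancel c a x : c != 0 -> divides (c * a) (c * x) -> divides a x.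
Proof.
by move=> c0 [u Eu]; exists u; apply: (mulfI c0); rewrite Eu mulrCA.
Qed.

Lemma divides_natr (m n : nat) : (m %| n)%N -> divides (m%:R : D) n%:R.
Proof. by move=> /dvdnP[k ->]; exists k%:R; rewrite natrM. Qed.

Lemma prime_elt_not_dvd1 a : prime_elt a -> ~ divides a 1.
Proof.
case=> _ /negP nu _ [c Ec]; apply: nu.
by apply/unitrP; exists c; rewrite [a * c]mulrC -Ec.
Qed.

(** The factors [a] are moved into [y] one at a time: primality extracts one from [y], and
    cancelling it lowers [n]. *)
Lemma prime_elt_gauss a n x y :
  prime_elt a -> ~ divides a x -> divides (a ^+ n) (x * y) ->
  divides (a ^+ n) y.
Proof.
move=> a_pr ax; elim: n y => [|n IHn] y a_xy.
  by exists y; rewrite expr0 mulr1.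
have [a0 _ aP] := a_pr.
have a_dvd : divides a (x * y).
  by apply: divides_trans a_xy; rewrite -[X in divides X]expr1; apply: divides_expr_le.
have [//|[z Ez]] := aP _ _ a_dvd.
have a_xz : divides (a * a ^+ n) (a * (x * z)).
  by rewrite -exprS [a * (_ * _)]mulrC -mulrA -Ez.
rewrite Ez exprSr; apply: divides_mul; last by exists 1; rewrite mul1r.
exact/IHn/(divides_cancel a0).
Qed.

Lemma prime_elt_not_dvd_prod a (s : seq D) :
  prime_elt a -> (forall x, x \in s -> ~ divides a x) ->
  ~ divides a (\prod_(x <- s) x).
Proof.
move=> a_pr; elim: s => [|x s IHs] sP.
  by rewrite big_nil; apply: prime_elt_not_dvd1.
rewrite big_cons; have [_ _ aP] := a_pr => /aP[]; first by apply: sP; rewrite mem_head.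
by apply: IHs => y ys; apply: sP; rewrite inE ys orbT.
Qed.

Lemma divides_prod_count a (s : seq D) :
  divides (a ^+ (size s - nb_non_multiples a s)) (\prod_(x <- s) x).
Proof.
elim: s => [|x s IHs]; first by rewrite big_nil; exists 1; rewrite mul1r.
rewrite big_cons /nb_non_multiples /=.
case: asboolP => [ax | _]; last by rewrite addnC addn1 subSS; apply: dividesMl.
by rewrite add0n subSn ?count_size // exprS; apply: divides_mul.
Qed.

(** Pigeonhole: an entry [c * a] with [c] not divisible by [a] uses up exactly one factor [a], so
    the surplus factor passes to the tail; it cannot survive down to the empty product 1. *)
Lemma prod_multiples a (s : seq D) :
  prime_elt a -> (forall x, x \in s -> divides a x) ->
  divides (a ^+ (size s).+1) (\prod_(x <- s) x) ->
  exists2 x, x \in s & divides (a ^+ 2) x.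
Proof.
move=> a_pr; have [a0 _ _] := a_pr.
elim: s => [|x s IHs] sP.
  by rewrite big_nil expr1 => /(prime_elt_not_dvd1 a_pr).
have [c Ec] := sP x (mem_head _ _).
have [a_c | a_c] := pselect (divides a c).
  move=> _; exists x; rewrite ?mem_head // Ec expr2.
  by apply: divides_mul => //; exists 1; rewrite mul1r.
rewrite big_cons Ec (mulrC c) -mulrA exprS => /(divides_cancel a0).
move=> /(prime_elt_gauss a_pr a_c) /IHs[|y ys a_y].
  by move=> y ys; apply: sP; rewrite inE ys orbT.
by exists y; rewrite // inE ys orbT.
Qed.

End Divisibility.

Local Notation lin_prod s := (\prod_(x <- s) ('X - x%:P)).

(** * Coefficients of a product of linear factors *)

Section Coefficients.
Variable D : idomainType.
Implicit Types (a : D) (s r : seq D).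

Lemma lin_prod_coefS x s k :
  (lin_prod (x :: s))`_k.+1 = (lin_prod s)`_k - x * (lin_prod s)`_k.+1.
Proof. by rewrite big_cons mulrBl coefB coefXM coefCM. Qed.

(** Up to sign, this coefficient is a sum of products of [size s - k] entries of [s]. For [k] beyond
    [size s] the truncated exponent is 0 and the claim is trivial. *)
Lemma lin_prod_coef_multiples a s k :
  (forall x, x \in s -> divides a x) ->
  divides (a ^+ (size s - k)) (lin_prod s)`_k.
Proof.
elim: s k => [|x s IHs] k sP.
  by rewrite sub0n expr0; exists (lin_prod [::])`_k; rewrite mulr1.
have ax := sP x (mem_head _ _).
have {}IHs j : divides (a ^+ (size s - j)) (lin_prod s)`_j.
  by apply: IHs => y ys; apply: sP; rewrite inE ys orbT.
case: k => [|k].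
  rewrite big_cons mulrBl coefB coefXM coefCM sub0r subn0 /= exprS.
  by apply/dividesN/divides_mul => //; move: (IHs 0%N); rewrite subn0.
rewrite lin_prod_coefS /= subSS; apply: dividesD => //; apply: dividesN.
apply: divides_trans (divides_mul ax (IHs k.+1)).
by rewrite -exprS; apply: divides_expr_le; lia.
Qed.

(* Modulo [a], the factors at multiples of [a] collapse to ['X]. *)
Lemma lin_prod_mod a s :
  exists h : {poly D}, lin_prod s =
    'X ^+ (size s - nb_non_multiples a s)
    * lin_prod [seq x <- s | ~~ `[< divides a x >]] + a *: h.
Proof.
rewrite /nb_non_multiples.
elim: s => [|x s [h IHs]].
  by exists 0; rewrite /= !big_nil expr0 mulr1 scaler0 addr0.
rewrite big_cons IHs /=; case: asboolP => [[c ->] | _] /=.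
  set g := lin_prod (filter _ _).
  set k := (size s - _)%N; rewrite add0n subSn ?count_size // -/k.
  exists (('X - (c * a)%:P) * h - c *: ('X ^+ k * g)).
  rewrite mulrDr scalerBr scalerA (mulrC a) [X in X + _]mulrBl -!mul_polyC.
  by rewrite exprS mulrA; ring.
rewrite big_cons addnC addn1 subSS; exists (('X - x%:P) * h).
by rewrite mulrDr scalerAr mulrCA.
Qed.

(** Let [j] be the number of multiples of [a] in [s]. Modulo [a], the coefficient of index [j] is,
    up to sign, the product of the non-multiples, which the prime [a] does not divide; hence [j]
    cannot be below [m]. *)
Lemma nb_non_multiples_le a s m :
  prime_elt a -> (forall k, (k < m)%N -> divides a (lin_prod s)`_k) ->
  (nb_non_multiples a s + m <= size s)%N.
Proof.
move=> a_pr coefP; rewrite -leq_subRL ?count_size // leqNgt.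
apply/negP => /coefP.
have [h ->] := lin_prod_mod a s.
rewrite coefD coefZ coefXnM ltnn subnn coef0_prod_XsubC => a_coef.
set g := [seq x <- s | _] in a_coef.
have : divides a ((-1) ^+ size g * \prod_(x <- g) x).
  rewrite -[X in divides a X](addrK (a * h`_(size s - nb_non_multiples a s))).
  apply: dividesD a_coef _; apply/dividesN/dividesMr.
  by exists 1; rewrite mul1r.
move=> /(dividesMl ((-1) ^+ size g)); rewrite mulrA -exprD addnn -mul2n.
rewrite exprM sqrrN expr1n expr1n mul1r; apply: prime_elt_not_dvd_prod => // x.
by rewrite mem_filter => /andP[/asboolPn].
Qed.

End Coefficients.

(** * Natural numbers inside a domain of characteristic zero *)

Section PrimeNumber.
Variable D : idomainType.
Hypothesis D_char0 : char_zero D.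

Lemma natr_eq0_char0 n : (n%:R == 0 :> D) = (n == 0)%N.
Proof. by move/pcharf0P: D_char0. Qed.

(* Comparing leading coefficients, the derivative of the monic
   [lin_prod r] is [(size r)%:R *: lin_prod s]. *)
Lemma deriv_root_lists (p : {poly D}) (r s : seq D) :
  (0 < size r)%N -> root_list p r -> root_list p^`() s ->
  size s = (size r).-1 /\
  forall k, (lin_prod r)`_k.+1 * k.+1%:R = (size r)%:R * (lin_prod s)`_k.
Proof.
case Er: (size r) => [//|n] _ [_ [c c0 Ep]] [_ [c' c'0 Ep']].
have size_lin t : size (lin_prod t : {poly D}) = (size t).+1.
  exact: size_prod_XsubC.
have lead_lin t : (lin_prod t : {poly D})`_(size t) = 1.
  by have /monicP := monic_prod_XsubC t xpredT id; rewrite lead_coefE size_lin.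
have E : c *: (lin_prod r)^`() = c' *: lin_prod s by rewrite -derivZ -Ep.
(* Characteristic zero keeps the leading coefficient [n.+1] of the derivative nonzero. *)
have size_deriv : size (lin_prod r)^`() = n.+1.
  apply/eqP; rewrite eqn_leq; apply/andP; split.
    by rewrite -ltnS -Er -(size_lin r) lt_size_deriv // monic_neq0 // monic_prod_XsubC.
  rewrite ltnNge; apply/negP => /leq_sizeP/(_ n (leqnn n))/eqP.
  by rewrite coef_deriv -Er lead_lin natr_eq0_char0 Er.
have size_s : size s = n.
  have := congr1 (size : {poly D} -> nat) E.
  by rewrite !size_scale // size_lin size_deriv => -[].
split=> // k; have Ek j : c * ((lin_prod r)`_j.+1 *+ j.+1) = c' * (lin_prod s)`_j.
  by rewrite -coef_deriv -!coefZ E.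
have Ec' : c' = c * n.+1%:R.
  by have := Ek n; rewrite -{1}Er lead_lin -size_s lead_lin mulr1.
by apply: (mulfI c0); rewrite mulr_natr Ek Ec' mulrA.
Qed.

Hypothesis D_int : rational_elts_are_integers D.

(** The inverse of [n] lies in [D] and is rational, hence is an integer [z] with [z * n = 1]. *)
Lemma natr_unit_eq1 n : (n%:R : D) \is a GRing.unit -> n = 1%N.
Proof.
move=> n_unit.
have n0 : n%:R != 0 :> D by apply: contraTneq n_unit => ->; rewrite unitr0.
have n_gt0 : (0 < n)%N by rewrite lt0n -natr_eq0_char0.
have [|z Ez] := (D_int n%:R^-1).1.
  exists (n%:Q^-1).
  have z0 : n%:Z != 0 by rewrite -lt0n.
  have -> : n%:Q^-1 = 1%:Q / n%:Q by rewrite div1r.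
  rewrite /ratr coprimeq_num ?coprimeq_den ?coprime1n // (negPf z0).
  rewrite gtr0_sg // mul1r div1r; set t := FracField.tofrac _.
  have n0' : FracField.tofrac (n%:R : D) != 0 by rewrite tofrac_eq0.
  apply: (mulfI n0'); rewrite -tofracM mulrV // tofrac1.
  by rewrite tofracMn tofrac1 in n0' *; rewrite [RHS]mulfV.
have zn : (z * n%:Z)%:~R = 1 :> D by rewrite intrM -Ez mulVr.
have intr0 (m : int) : m%:~R = 0 :> D -> m = 0.
  case: m => m; first by move=> /eqP; rewrite natr_eq0_char0 => /eqP ->.
  by rewrite NegzE => /eqP; rewrite intrN oppr_eq0 natr_eq0_char0.
have /intr0/eqP : (z * n%:Z - 1)%:~R = 0 :> D by rewrite intrB zn subrr.
rewrite subr_eq0 => /eqP/(congr1 absz)/eqP.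
by rewrite abszM muln_eq1 => /andP[_ /eqP].
Qed.

(** If [b] is the product of two naturals, it divides one of them in [D]; the other is then a unit
    of [D], hence 1. *)
Lemma natr_prime_elt b : prime_elt (b%:R : D) -> prime b.
Proof.
move=> b_pr; have [b0 b_nunit bP] := b_pr.
have b_gt0 : (0 < b)%N by rewrite lt0n -natr_eq0_char0.
have unit_of m n : b = (m * n)%N -> divides b%:R (m%:R : D) -> n = 1%N.
  move=> Eb [c Ec]; apply: natr_unit_eq1; apply/unitrP; exists c.
  suff cn : c * n%:R = 1 by rewrite [n%:R * c]mulrC cn.
  by apply: (mulfI b0); rewrite mulr1 {2}Eb natrM Ec mulrCA mulrA.
apply/primeP; split.
  rewrite ltn_neqAle b_gt0 andbT eq_sym; apply: contraNneq b_nunit => ->.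
  exact: unitr1.
move=> m /dvdnP[n Eb].
have /bP[] : divides b%:R (n%:R * m%:R : D).
  by rewrite -natrM -Eb; exists 1; rewrite mul1r.
  by move=> /(unit_of _ _ Eb) ->.
by rewrite mulnC in Eb; move=> /(unit_of _ _ Eb) n1; rewrite Eb n1 muln1 eqxx orbT.
Qed.

(** If [b] did not divide [n] in the naturals, Bezout would give [k] with [b] dividing [1 + k * n],
    and [b] would divide 1 in [D]. *)
Lemma divides_natr_prime b n :
  prime_elt (b%:R : D) -> divides (b%:R : D) n%:R -> (b %| n)%N.
Proof.
move=> b_pr b_n; have b_prime := natr_prime_elt b_pr.
apply: contraT => b'n.
have [k _] := Bezoutl n (prime_gt0 b_prime).
have /eqP -> : coprime b n by rewrite prime_coprime.
move=> /(divides_natr D); rewrite natrD natrM => b_1kn.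
case: (prime_elt_not_dvd1 b_pr); rewrite -[X in divides _ X](addrK (k%:R * n%:R : D)).
by apply: dividesD b_1kn _; apply/dividesN/dividesMl.
Qed.

End PrimeNumber.

Unset Implicit Arguments.

Theorem theorem6p3 (D : idomainType)
    (D_ufd : factorial_domain D)
    (D_char0 : char_zero D)
    (D_int : rational_elts_are_integers D)
    (b e : nat) (b_gt0 : (0 < b)%N) (e_gt0 : (0 < e)%N)
    (b_prime : prime_elt (b%:R : D))
    (p : {poly D}) (p_nice : nice p) (p_deg : (size p).-1 = (b ^ e)%N)
    (p_root0 : root p 0)
    (r : seq D) (r_roots : root_list p r)
    (s : seq D) (s_crit : root_list p^`() s) :
  [/\ forall x, x \in r -> divides b%:R x,
      (nb_non_multiples b%:R s <= e)%N
    & count_mem 0 r = 1%N -> divides (b%:R : D) e%:R ->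
      (exists x, [/\ x \in r, x != 0 & divides (b%:R ^+ 2) x]) /\
      (nb_non_multiples b%:R s <= e - 1)%N].
Proof.
have prime_b := natr_prime_elt D_char0 D_int b_prime.
have b_gt1 := prime_gt1 prime_b.
have [b0 _ bP] := b_prime.
have size_r : size r = (b ^ e)%N by case: r_roots => ->.
have e_lt_d : (e < b ^ e)%N by apply: ltn_expl.
have r_gt0 : (0 < size r)%N by rewrite size_r expn_gt0 b_gt0.
have [size_s coefE] := deriv_root_lists D_char0 r_gt0 r_roots s_crit.
rewrite size_r natrX in coefE size_s.
have q0 : (lin_prod r)`_0 = 0.
  case: r_roots => _ [c c0 Ep]; move: p_root0.
  by rewrite Ep rootZ // /root horner_coef0 => /eqP.
have coef_r k : (k < b ^ e)%N -> divides b%:R (lin_prod r)`_k.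
  case: k => [_|k k_lt]; first by rewrite q0; apply: divides0.
  (* Write [k.+1] as [m * b ^ v] with [m] prime to [b]. Since [k.+1 < b ^ e], [v < e], so cancelling
     [b ^ v] in [coefE] leaves at least one factor [b], which must divide the coefficient. *)
  have [m b'm Ek] := pfactor_coprime prime_b (ltn0Sn k).
  set v := logn b k.+1 in Ek.
  have m_gt0 : (0 < m)%N by case: m Ek {b'm}.
  have v_lt : (v < e)%N.
    rewrite -(ltn_exp2l _ _ b_gt1); apply: leq_ltn_trans k_lt.
    by rewrite Ek leq_pmull.
  have b'm_D : ~ divides (b%:R : D) m%:R.
    move=> /(divides_natr_prime D_char0 D_int b_prime).
    by apply/negP; rewrite -prime_coprime.
  rewrite -[X in divides X]expr1; apply: prime_elt_gauss b_prime b'm_D _.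
  exists (b%:R ^+ (e - v).-1 * (lin_prod s)`_k).
  apply: (@mulfI _ (b%:R ^+ v)); first by rewrite expf_neq0.
  have -> : b%:R ^+ v * (m%:R * (lin_prod r)`_k.+1) = b%:R ^+ e * (lin_prod s)`_k.
    by rewrite -coefE Ek natrM natrX; ring.
  have -> : e = (v + (e - v).-1.+1)%N by lia.
  by rewrite addKn !exprD exprS; ring.
have r_mult x : x \in r -> divides b%:R x.
  (* All [b ^ e] coefficients below the leading one are multiples of [b], so the count bound leaves
     no room for a non-multiple. *)
  have nb_r : nb_non_multiples b%:R r = 0%N.
    by have := nb_non_multiples_le b_prime coef_r; rewrite size_r in r_gt0 *; lia.
  move=> xr; apply: contrapT => /asboolPn b'x; move/eqP: nb_r.
  by rewrite -leqn0 leqNgt -has_count => /hasPn/(_ x xr); rewrite negbK (negPf b'x).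
have coef_s k : divides (b%:R ^+ e.+1) ((lin_prod r)`_k.+1 * k.+1%:R) ->
    divides b%:R (lin_prod s)`_k.
  by rewrite coefE exprSr; apply: divides_cancel; rewrite expf_neq0.
have coef_r_pow k m : (m + k <= b ^ e)%N -> divides (b%:R ^+ m) (lin_prod r)`_k.
  move=> mk; apply: divides_trans (lin_prod_coef_multiples k r_mult).
  by apply: divides_expr_le; rewrite size_r; lia.
split=> //.
  have coef_s_lt k : (k < b ^ e - 1 - e)%N -> divides b%:R (lin_prod s)`_k.
    by move=> k_lt; apply/coef_s/dividesMr/coef_r_pow; lia.
  by have := nb_non_multiples_le b_prime coef_s_lt; rewrite size_s; lia.
move=> r_simple0 b_e.
have nb_s : (nb_non_multiples b%:R s <= e - 1)%N.
  have coef_s_lt k : (k < b ^ e - e)%N -> divides b%:R (lin_prod s)`_k.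
    (* The new index is [k.+1 = b ^ e - e]: the coefficient of [lin_prod r] supplies only [b ^ e],
       and the missing factor [b] comes from [k.+1] itself, as [b] divides both [b ^ e] and [e]. *)
    move=> k_lt; apply: coef_s; have [Ek|Ek] := eqVneq k.+1 (b ^ e - e)%N; last first.
      by apply/dividesMr/coef_r_pow; lia.
    rewrite exprSr; apply: divides_mul; first by apply: coef_r_pow; lia.
    rewrite Ek; apply/divides_natr/dvdn_sub; first by rewrite dvdn_exp.
    exact: (divides_natr_prime D_char0 D_int b_prime).
  by have := nb_non_multiples_le b_prime coef_s_lt; rewrite size_s; lia.
split=> //.
have r0 : 0 \in r by rewrite -has_pred1 has_count r_simple0.
have perm_r := perm_to_rem r0; set r' := rem 0 r in perm_r.
have size_r' : (size r').+1 = (b ^ e)%N by rewrite -size_r (perm_size perm_r).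
have r'_sub x : x \in r' -> x \in r by apply: mem_rem.
(* The constant term of [lin_prod r'] is the coefficient of index 1 of [lin_prod r], so [coefE] at 0
   equates the two products up to signs and the factor [b ^ e]. At least [b ^ e - e] entries of [s]
   are multiples of [b], giving [b ^ e] factors [b] in all: one more than [r'] has entries. *)
have prod_r' : divides (b%:R ^+ (size r').+1) (\prod_(x <- r') x).
  have := coefE 0%N; rewrite (perm_big _ perm_r) big_cons subr0 coefXM /= mulr1.
  rewrite !coef0_prod_XsubC => E.
  have -> : \prod_(x <- r') x =
      (-1) ^+ size r' * (-1) ^+ size s * (b%:R ^+ e * \prod_(x <- s) x).
    by rewrite -[LHS](signrMK (size r')) E; ring.
  apply/dividesMl.
  apply: divides_trans (divides_mul _ (divides_prod_count b%:R s)); last first.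
    by exists 1; rewrite mul1r.
  by rewrite -exprD; apply: divides_expr_le; rewrite size_s size_r'; lia.
have [x xr' b2_x] := prod_multiples b_prime (fun x xr' => r_mult x (r'_sub x xr')) prod_r'.
exists x; split=> //; first exact: r'_sub.
apply: contraTneq xr' => ->; rewrite -has_pred1 has_count.
by rewrite count_mem_rem r_simple0 eqxx.
Qed.
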